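(* Let $(\mathcal{K}_n,\mu_n)_{n\in\mathbb{N}}$ be a scale family over a countable first-order language $\mathcal{L}$, decisive on $\operatorname{Sent}(\mathcal{L})$, with limit theory $T_\infty$, and let $T_\infty$ be countable. Suppose that for every finite $\Delta\subseteq T_\infty$ there exists $N_\Delta$ such that for all $n\ge N_\Delta$ some structure in $\mathcal{K}_n$ satisfies $\Delta$. Then there are structures $\mathfrak{M}_n\in\mathcal{K}_n$ ($n\in\mathbb{N}$) and a nonprincipal ultrafilter $\mathcal{U}$ on $\mathbb{N}$ such that \[ \prod_{n\to\mathcal{U}}\mathfrak{M}_n\models T_\infty . \]
   Context: Each $\mathcal{K}_n$ is a nonempty class of $\mathcal{L}$-structures and $\mu_n$ is a probability measure on a $\sigma$-algebra containing all sets $\{\mathfrak{M}\in\mathcal{K}_n:\mathfrak{M}\models\varphi\}$; $s_n(\varphi)$ denotes the measure of this set. Decisive on $\operatorname{Sent}(\mathcal{L})$ means that for every $\mathcal{L}$-sentence $\varphi$ the limit $\lim_{n\to\infty}s_n(\varphi)$ exists and is $0$ or $1$; $T_\infty:=\{\varphi\in\operatorname{Sent}(\mathcal{L}):\lim_n s_n(\varphi)=1\}$. $\prod_{n\to\mathcal{U}}\mathfrak{M}_n$ is the ultraproduct of the $\mathfrak{M}_n$ modulo $\mathcal{U}$. *)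

(* Defs.v *)
From HB Require Import structures.
From mathcomp Require Import all_boot all_order all_algebra.
From mathcomp Require Import all_classical all_reals all_analysis.

Set Implicit Arguments.
Unset Strict Implicit.
Unset Printing Implicit Defensive.

Import Order.TTheory GRing.Theory Num.Theory.
Import numFieldNormedType.Exports.

Local Open Scope classical_set_scope.
Local Open Scope ring_scope.

(* Constants are the function symbols of arity 0. *)
Record language := Language {
  fun_symb : Type;
  fun_arity : fun_symb -> nat;
  rel_symb : Type;
  rel_arity : rel_symb -> nat
}.

(* Countable includes finite. *)
Definition countable_language (L : language) : Prop :=
  countable [set: fun_symb L] /\ countable [set: rel_symb L].

(* Well-scoped de Bruijn syntax: the index n bounds the free variables, which
   are numbered by 'I_n, and a quantifier binds the variable 0 of its body. *)
Inductive term (L : language) (n : nat) : Type :=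
| TVar of 'I_n
| TFun (f : fun_symb L) of ('I_(fun_arity f) -> term L n).

Inductive formula (L : language) : nat -> Type :=
| FEq n of term L n & term L n : formula L n
| FRel n (r : rel_symb L) of ('I_(rel_arity r) -> term L n) : formula L n
| FBot n : formula L n
| FNot n of formula L n : formula L n
| FAnd n of formula L n & formula L n : formula L n
| FOr n of formula L n & formula L n : formula L n
| FImp n of formula L n & formula L n : formula L n
| FAll n of formula L n.+1 : formula L n
| FEx n of formula L n.+1 : formula L n.

Definition sentence (L : language) : Type := formula L 0.

Record structure (L : language) := Structure {
  carrier :> Type;
  carrier_inhabited : inhabited carrier;
  fun_interp : forall f : fun_symb L, ('I_(fun_arity f) -> carrier) -> carrier;
  rel_interp : forall r : rel_symb L, ('I_(rel_arity r) -> carrier) -> Prop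
}.

Definition env_nil (A : Type) : 'I_0 -> A :=
  fun i => False_rect A (notF (ltn_ord i)).

Definition env_cons (A : Type) (n : nat) (x : A) (e : 'I_n -> A) :
    'I_n.+1 -> A :=
  fun i => oapp e x (unlift ord0 i).

Fixpoint eval (L : language) (M : structure L) (n : nat) (e : 'I_n -> M)
    (t : term L n) : M :=
  match t with
  | TVar i => e i
  | TFun f ts => fun_interp (fun i => eval e (ts i))
  end.

Fixpoint sat (L : language) (M : structure L) (n : nat) (phi : formula L n) :
    ('I_n -> M) -> Prop :=
  match phi in formula _ n return ('I_n -> M) -> Prop with
  | FEq _ t u => fun e => eval e t = eval e u
  | FRel _ r ts => fun e => rel_interp (fun i => eval e (ts i))
  | FBot _ => fun _ => False
  | FNot _ p => fun e => ~ sat p e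
  | FAnd _ p q => fun e => sat p e /\ sat q e
  | FOr _ p q => fun e => sat p e \/ sat q e
  | FImp _ p q => fun e => sat p e -> sat q e
  | FAll _ p => fun e => forall x : M, sat p (env_cons x e)
  | FEx _ p => fun e => exists x : M, sat p (env_cons x e)
  end.

Definition models (L : language) (M : structure L) (phi : sentence L) : Prop :=
  sat phi (@env_nil M).

Definition models_theory (L : language) (M : structure L)
    (T : set (sentence L)) : Prop :=
  forall phi, T phi -> models M phi.

Definition nonprincipal (I : Type) (U : set_system I) : Prop :=
  forall i, U <> principal_filter i.

(* The elements of the ultraproduct are the classes of sequences modulo
   U-almost everywhere equality. A class is represented by its membership
   predicate: the generic quotients {eq_quot e} would tie the universe of the
   carriers to that of choiceType, which has to contain the (strictly larger)
   type of all structures. *)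
Section Ultraproduct.
Variables (L : language) (I : Type) (U : set_system I).
Variable M : I -> structure L.

Definition ae_eq_seq (f g : forall i, M i) : Prop := U [set i | f i = g i].

Definition ultra_carrier : Type :=
  {A : (forall i, M i) -> Prop | exists f, A = ae_eq_seq f}.

Definition ultra_class (f : forall i, M i) : ultra_carrier :=
  exist _ (ae_eq_seq f) (ex_intro _ f erefl).

Definition ultra_repr (a : ultra_carrier) : forall i, M i :=
  sval (cid (svalP a)).

Lemma ultra_reprK (a : ultra_carrier) : ultra_class (ultra_repr a) = a.
Proof.
rewrite /ultra_repr; case: cid => f /= af; case: a af => A AP /= Af.
by rewrite /ultra_class; apply: eq_exist.
Qed.

Lemma ultra_classP (UU : UltraFilter U) (f g : forall i, M i) :
  ultra_class f = ultra_class g <-> ae_eq_seq f g.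
Proof.
split=> [/(congr1 sval)/= fg|fg].
  by rewrite fg /ae_eq_seq; apply: filterS filterT.
apply: eq_exist; apply/funext => h; apply/propext; rewrite /ae_eq_seq.
split=> [fh|gh]; last by apply: filterS2 fg gh => i /= -> ->.
by apply: filterS2 fg fh => i /= -> ->.
Qed.

Lemma ultra_classK (UU : UltraFilter U) (f : forall i, M i) :
  ae_eq_seq (ultra_repr (ultra_class f)) f.
Proof. by apply/ultra_classP; rewrite ultra_reprK. Qed.

Lemma ultra_inhabited : inhabited ultra_carrier.
Proof.
have M0 i : exists x : M i, True by case: (carrier_inhabited (M i)) => x; exists x.
exact: inhabits (ultra_class (fun i => sval (cid (M0 i)))).
Qed.

(* Operations and relations are computed on chosen representatives; when U is
   an ultrafilter, this does not depend on the choice. *)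
Definition ultraproduct : structure L := @Structure L ultra_carrier
  ultra_inhabited
  (fun f a => ultra_class (fun i => fun_interp (fun k => ultra_repr (a k) i)))
  (fun r a => U [set i | rel_interp (fun k => ultra_repr (a k) i)]).

End Ultraproduct.
Arguments ultraproduct {L I} U M.

(* A nonempty class of structures as a pointed type; the point is arbitrary and
   only needed by the measure library. *)
Definition class_type (L : language) (K : set (structure L)) (K0 : K !=set0) :
  Type := {M : structure L | K M}.

Section ClassType.
Variables (L : language) (K : set (structure L)) (K0 : K !=set0).
HB.instance Definition _ := gen_eqMixin (class_type K0).
HB.instance Definition _ := gen_choiceMixin (class_type K0).
HB.instance Definition _ := isPointed.Build (class_type K0)
  (exist _ (sval (cid K0)) (svalP (cid K0))).
End ClassType.

Definition model_event (L : language) (K : set (structure L)) (K0 : K !=set0)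
    (phi : sentence L) : set (class_type K0) :=
  [set M | models (sval M) phi].
Arguments model_event {L K} K0 phi.

(* As sf_sigma n is a sigma-algebra, the measurable sets of
   g_sigma_algebraType (sf_sigma n) are exactly those of sf_sigma n. *)
Record scale_family (R : realType) (L : language) := ScaleFamily {
  sf_class : nat -> set (structure L);
  sf_nonempty : forall n, sf_class n !=set0;
  sf_sigma : forall n, set (set (class_type (sf_nonempty n)));
  sf_sigma_algebra : forall n, sigma_algebra setT (@sf_sigma n);
  sf_event : forall n phi, @sf_sigma n (model_event (sf_nonempty n) phi);
  sf_prob : forall n, probability (g_sigma_algebraType (@sf_sigma n)) R
}.

Section ScaleFamily.
Variables (R : realType) (L : language) (F : scale_family R L).

Definition sprob (phi : sentence L) (n : nat) : R :=
  fine (sf_prob F n (model_event (sf_nonempty F n) phi)).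

Definition decisive_on (S : set (sentence L)) : Prop :=
  forall phi, S phi -> (sprob phi @ \oo --> (0 : R)) \/ (sprob phi @ \oo --> (1 : R)).

Definition limit_theory : set (sentence L) :=
  [set phi | sprob phi @ \oo --> (1 : R)].

End ScaleFamily.

(* Main.v *)
Require Import Defs.
From mathcomp Require Import all_boot all_order all_algebra.
From mathcomp Require Import all_classical all_reals all_analysis.

(** Enumerate [T_oo] and let [D_m] be the set of its first [m] sentences. Choose
    [M_n] in [K_n] to satisfy [D_m] for the largest [m <= n] such that some
    structure of [K_n] does; as the [D_m] increase, [M_n] then satisfies every
    [D_m] with [m <= n] that has a model in [K_n]. So every sentence of [T_oo]
    holds in all but finitely many [M_n], and Łoś's theorem applies to any
    ultrafilter extending the cofinite filter. *)

Local Open Scope classical_set_scope.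

Section Ultrafilters.
Context {I : Type} (U : set_system I) {UU : UltraFilter U}.

Lemma ultra_setC (A : set I) : U (~` A) <-> ~ U A.
Proof.
split=> [UCA UA|nUA]; last by case: (in_ultra_setVsetC A UU).
apply: (@filter_not_empty _ U).
by rewrite -(setICr A); exact: filterI.
Qed.

Lemma ultra_setI (A B : set I) : U (A `&` B) <-> U A /\ U B.
Proof.
split=> [UAB|[UA UB]]; last exact: filterI.
by split; apply: filterS UAB => i [].
Qed.

Lemma ultra_setU (A B : set I) : U (A `|` B) <-> U A \/ U B.
Proof.
split=> [UAB|[] UA]; last 2 first.
- by apply: filterS UA => i; left.
- by apply: filterS UA => i; right.
apply: contrapT => /not_orP[/ultra_setC UA /ultra_setC UB].
apply: (@filter_not_empty _ U).
rewrite -(setICr (A `|` B)) setCU.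
by do 2?apply: filterI.
Qed.

End Ultrafilters.

Section Los.
Context {L : language} {I : Type} {U : set_system I} {UU : UltraFilter U}.
Variable M : I -> structure L.

Local Notation UM := (ultraproduct U M).
Local Notation cls := (ultra_class U).

(** A tuple has finitely many coordinates, so the coordinatewise agreements hold together on one set
    of [U]. *)
Lemma ae_eq_tuple (n : nat) (P : forall i, ('I_n -> M i) -> Prop)
    (e e' : 'I_n -> forall i, M i) :
  (forall k, ae_eq_seq U (e k) (e' k)) ->
  U [set i | P i (e ^~ i)] <-> U [set i | P i (e' ^~ i)].
Proof.
move=> /filter_forall ee'.
by split=> UP; apply: filterS2 ee' UP => i /= /funext eqi; rewrite eqi.
Qed.

(** Operations use chosen representatives; by induction these agree almost everywhere with the
    values of the arguments, and there are finitely many arguments. *)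
Lemma eval_ultraproduct (n : nat) (t : term L n) (e : 'I_n -> forall i, M i) :
  @Defs.eval L UM n (fun k => cls (e k)) t = cls (fun i => @Defs.eval L (M i) n (e ^~ i) t).
Proof.
elim: t => [//|f ts IH] /=.
apply/(@ultra_classP _ _ _ _ UU).
have /filter_forall ee k : ae_eq_seq U
    (ultra_repr (@Defs.eval L UM n (fun k => cls (e k)) (ts k)))
    (fun i => @Defs.eval L (M i) n (e ^~ i) (ts k)).
  by rewrite IH; exact: ultra_classK.
by apply: filterS ee => i /= /funext ->.
Qed.

Lemma env_cons_ultraproduct (n : nat) (x : forall i, M i)
    (e : 'I_n -> forall i, M i) :
  @env_cons UM n (cls x) (fun k => cls (e k)) =
  fun k => cls (fun i => env_cons (x i) (e ^~ i) k).
Proof.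
by apply/funext => k; rewrite /env_cons; case: (unlift _ _).
Qed.

Lemma exists_ultraproduct (P : forall i, M i -> Prop) (Q : UM -> Prop) :
  (forall d, Q (cls d) <-> U [set i | P i (d i)]) ->
  (exists x, Q x) <-> U [set i | exists x, P i x].
Proof.
move=> PQ; split=> [[x]|Uex].
  rewrite -(ultra_reprK x) => /PQ.
  by apply: filterS => i /= ?; exists (ultra_repr x i).
(* A witness wherever there is one, and an arbitrary element elsewhere, so that the choice gives a
   sequence defined at every index. *)
have wit i : exists x : M i, (exists y, P i y) -> P i x.
  have [[y py]|np] := pselect (exists y, P i y); first by exists y.
  by have [y] := carrier_inhabited (M i); exists y.
exists (cls (fun i => sval (cid (wit i)))); apply/PQ.
by apply: filterS Uex => i /=; case: cid.
Qed.

(** Dual to the existential case, since an ultrafilter commutes with complements. *)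
Lemma forall_ultraproduct (P : forall i, M i -> Prop) (Q : UM -> Prop) :
  (forall d, Q (cls d) <-> U [set i | P i (d i)]) ->
  (forall x, Q x) <-> U [set i | forall x, P i x].
Proof.
move=> PQ.
have : (exists x, ~ Q x) <-> U [set i | exists x, ~ P i x].
  apply: exists_ultraproduct => d.
  by rewrite PQ; exact: iff_sym (ultra_setC _ _).
rewrite existsNE (_ : [set i | _] = ~` [set i | forall x, P i x]); last first.
  by apply/funext => i; exact: existsNE.
by rewrite ultra_setC => PQN; split=> H; apply: contrapT => /PQN.
Qed.

(** Łoś's theorem, by induction on [phi] with [e] general, because quantifiers extend the
    environment. *)
Lemma sat_ultraproduct (n : nat) (phi : formula L n)
    (e : 'I_n -> forall i, M i) :
  @sat L UM n phi (fun k => cls (e k)) <->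
  U [set i | @sat L (M i) n phi (e ^~ i)].
Proof.
elim: phi e => {n} [n t u|n r ts|n|n p IHp|n p IHp q IHq|n p IHp q IHq
  |n p IHp q IHq|n p IHp|n p IHp] e /=.
- by rewrite !eval_ultraproduct; exact: ultra_classP.
- have ee k : ae_eq_seq U
      (ultra_repr (@Defs.eval L UM n (fun k => cls (e k)) (ts k)))
      (fun i => @Defs.eval L (M i) n (e ^~ i) (ts k)).
    by rewrite eval_ultraproduct; exact: ultra_classK.
  exact: (ae_eq_tuple _ (fun i => @rel_interp L (M i) r) _ _ ee).
- by split=> // /filter_not_empty.
- by rewrite IHp; exact: iff_sym (ultra_setC _ _).
- by rewrite IHp IHq; exact: iff_sym (ultra_setI _ _ _).
- by rewrite IHp IHq; exact: iff_sym (ultra_setU _ _ _).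
- rewrite IHp IHq implyE -ultra_setC -ultra_setU.
  rewrite (_ : _ `|` _ = [set i | @sat L (M i) n p (e ^~ i) ->
    @sat L (M i) n q (e ^~ i)]) //.
  by apply/funext => i; exact/esym/implyE.
- apply: (forall_ultraproduct
    (fun i x => @sat L (M i) n.+1 p (env_cons x (e ^~ i)))) => d.
  by rewrite env_cons_ultraproduct IHp.
- apply: (exists_ultraproduct
    (fun i x => @sat L (M i) n.+1 p (env_cons x (e ^~ i)))) => d.
  by rewrite env_cons_ultraproduct IHp.
Qed.

Lemma models_ultraproduct (phi : sentence L) :
  models UM phi <-> U [set i | models (M i) phi].
Proof.
pose e : 'I_0 -> forall i, M i := @env_nil _.
(* All empty environments are equal, which puts [env_nil] into the form of a tuple of classes. *)
have nilE A (f : 'I_0 -> A) : @env_nil A = f by apply/funext; case.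
rewrite /models (nilE _ (fun k => cls (e k))) sat_ultraproduct.
rewrite (_ : [set i | sat phi _] = [set i | models (M i) phi]) //.
by apply/funext => i /=; rewrite /models (nilE _ (e ^~ i)).
Qed.

End Los.

Lemma nonprincipal_cofinite (U : set_system nat) :
  \oo `<=` U -> UltraFilter U -> nonprincipal U.
Proof.
move=> ooU UU i Ui.
have := ooU _ (nbhs_infty_gt i).
by rewrite Ui => /(_ i erefl); rewrite /= ltnn.
Qed.

Lemma eventual_models (L : language) (K : nat -> set (structure L))
    (T : set (sentence L)) :
  (forall n, K n !=set0) -> countable T ->
  (forall D, finite_set D -> D `<=` T -> exists N, forall n, (N <= n)%N ->
     exists2 M, K n M & models_theory M D) ->
  exists M : nat -> structure L, (forall n, K n (M n)) /\
    forall phi, T phi -> \forall n \near \oo, models (M n) phi.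
Proof.
move=> K0 /countable_injP[g g_inj] finsat.
pose D m : set (sentence L) := [set phi | T phi /\ (g phi < m)%N].
have finD m : finite_set (D m).
  (* [g] is injective on [T], so [D m] is equinumerous with a set of codes below [m]. *)
  have /card_esym/eq_finite_set-> : (g @` D m #= D m)%card.
    apply: inj_card_eq => x y /set_mem[Tx _] /set_mem[Ty _].
    by apply: g_inj; exact: mem_set.
  by apply: (sub_finite_set _ (finite_II m)) => _ [phi [_ ?] <-].
(* The bound [k] is kept apart from [n] to allow induction on it; the diagonal [k = n] is used
   afterwards. *)
have best n k : exists M, K n M /\ forall m, (m <= k)%N ->
    (exists2 M', K n M' & models_theory M' (D m)) -> models_theory M (D m).
  elim: k => [|k [M [KM Mk]]].
    have [M KM] := K0 n; exists M; split=> // m.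
    (* [D 0] is empty, so any member of [K n] will do. *)
    by rewrite leqn0 => /eqP-> _ phi [].
  have [[M' KM' M'D]|noM'] := pselect
      (exists2 M', K n M' & models_theory M' (D k.+1)).
    exists M'; split=> // m mk _ phi [Tphi gphi].
    by apply: M'D; split=> //; exact: leq_trans mk.
  exists M; split=> // m; rewrite leq_eqVlt => /orP[/eqP-> //|].
  exact: Mk.
have [M MP] := choice (fun n => best n n).
exists M; split=> [n|phi Tphi]; first by have [] := MP n.
(* The successor puts [phi] itself into the finite set; [n] must then exceed both [g phi] and the
   threshold [N], up to equality for the latter. *)
have [||N satN] := finsat (D (g phi).+1); [exact: finD|by move=> ? []|].
near=> n.
have [_ /(_ (g phi).+1)] := MP n; apply=> //.
- by near: n; exact: nbhs_infty_ge.
- by apply: satN; near: n; exact: nbhs_infty_ge.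
Unshelve. all: by end_near. Qed.

Theorem theorem6p6 (R : realType) (L : language) (F : scale_family R L)
  (L_countable : countable_language L)
  (F_decisive : decisive_on F [set: sentence L])
  (T_countable : countable (limit_theory F))
  (F_finsat : forall D : set (sentence L),
     finite_set D -> D `<=` limit_theory F ->
     exists N : nat, forall n : nat, (N <= n)%N ->
       exists2 M : structure L, sf_class F n M & models_theory M D) :
  exists (M : nat -> structure L) (U : set_system nat),
    [/\ forall n, sf_class F n (M n),
        UltraFilter U,
        nonprincipal U &
        models_theory (ultraproduct U M) (limit_theory F)].
Proof.
have [M [KM Mphi]] := eventual_models _ _ _ (sf_nonempty F) T_countable F_finsat.
have [U [UU ooU]] := ultraFilterLemma (eventually_filter : ProperFilter \oo).
exists M, U; split=> //; first exact: nonprincipal_cofinite.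
by move=> phi /Mphi/ooU; apply: (proj2 (models_ultraproduct _ _)).
Qed.
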